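(* Let $\Omega_i\subseteq\mathbb{C}^{n_i}$, $i=1,2,\dots,k$, be bounded domains and let $\Omega=\Omega_1\times\Omega_2\times\dots\times\Omega_k\subseteq\mathbb{C}^n$, where $n=n_1+n_2+\dots+n_k$. Then for any $a=(a_1,a_2,\dots,a_k)\in\Omega$ with $a_i\in\Omega_i$, $i=1,\dots,k$, $$T_\Omega(a)\ge \min_{1\le i\le k} T_{\Omega_i}(a_i).$$ In particular, a product of (finitely many) holomorphic homogeneous regular domains is holomorphic homogeneous regular.
   Context: $\mathbb{D}^n(0,r)=\{w\in\mathbb{C}^n: |w_i|<r,\ 1\le i\le n\}$ is the open polydisk of radius $r$ centered at the origin, and $\mathbb{D}^n=\mathbb{D}^n(0,1)$. A holomorphic embedding is an injective holomorphic map. For a bounded domain (connected open set) $\Omega\subseteq\mathbb{C}^n$ and $z\in\Omega$, the squeezing function corresponding to the polydisk is $T_\Omega(z)=\sup_f \sup\{r>0:\mathbb{D}^n(0,r)\subseteq f(\Omega)\}$, the outer supremum being over holomorphic embeddings $f:\Omega\to\mathbb{D}^n$ with $f(z)=0$. A bounded domain $\Omega$ is holomorphic homogeneous regular if $T_\Omega$ has a positive lower bound on $\Omega$. *)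

(* Defs.v *)
From HB Require Import structures.
From mathcomp Require Import all_boot all_order all_algebra.
From mathcomp Require Import complex.
From mathcomp Require Import all_classical all_reals all_analysis.

Set Implicit Arguments.
Unset Strict Implicit.
Unset Printing Implicit Defensive.

Import Order.TTheory GRing.Theory Num.Theory.
Import numFieldNormedType.Exports.

Local Open Scope classical_set_scope.
Local Open Scope complex_scope.
Local Open Scope ring_scope.

(* The complex numbers R[i], presented through their numFieldType structure:
   the topology and the norm that the library puts on 'rV[K]_n (sup norm) are
   inferred from that structure, and the normed space is then over R[i], so
   that [differentiable] means complex differentiability. *)
Definition cplx (R : realType) : numFieldType := R[i].

Section Squeezing.
Variable R : realType.
Local Notation C := (cplx R).

Definition polydisk (n : nat) (r : R) : set 'rV[C]_n :=
  [set w : 'rV[C]_n | forall i : 'I_n, `|w ord0 i| < (r%:C : C)].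

Definition bounded_domain (n : nat) (Omega : set 'rV[C]_n) : Prop :=
  [/\ open Omega, connected Omega & bounded_set Omega].

(* Maps defined on an open set Omega are represented by total functions, of
   which only the values on Omega matter. *)
Definition holomorphic_on (n m : nat) (Omega : set 'rV[C]_n)
    (f : 'rV[C]_n -> 'rV[C]_m) : Prop :=
  forall z, Omega z -> differentiable f z.

Definition holomorphic_embedding (n m : nat) (Omega : set 'rV[C]_n)
    (D : set 'rV[C]_m) (f : 'rV[C]_n -> 'rV[C]_m) : Prop :=
  [/\ holomorphic_on Omega f,
      (forall z w, Omega z -> Omega w -> f z = f w -> z = w)
    & f @` Omega `<=` D].

(* Both suprema are taken in the extended reals, where every set has a
   supremum (the empty one has -oo).  For a bounded domain in dimension
   n >= 1 and z in Omega, the value is a real number in ]0, 1]. *)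
Definition squeezing (n : nat) (Omega : set 'rV[C]_n) (z : 'rV[C]_n) : \bar R :=
  ereal_sup
    [set ereal_sup [set r%:E | r in
                     [set r : R | 0 < r /\ polydisk r `<=` f @` Omega]]
    | f in [set f : 'rV[C]_n -> 'rV[C]_n |
             holomorphic_embedding Omega (polydisk 1) f /\ f z = 0]].

Definition holomorphic_homogeneous_regular (n : nat) (Omega : set 'rV[C]_n)
    : Prop :=
  bounded_domain Omega /\
  exists c : R, 0 < c /\ forall z, Omega z -> (c%:E <= squeezing Omega z)%E.

(* The product of the Omega i in C^(n_1 + ... + n_k); [submxrow z i] is the
   i-th block, in C^(n_i), of the row vector z. *)
Definition product_set (k : nat) (n : 'I_k -> nat)
    (Omega : forall i, set 'rV[C]_(n i)) : set 'rV[C]_(\sum_i n i) :=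
  [set z | forall i, Omega i (submxrow z i)].

End Squeezing.

(* Main.v *)
(* A polydisk is the product of the polydisks of the same radius in the
   blocks.  So if embeddings [f i] of the factors have images containing the
   polydisks of radii [r i], the map acting by [f i] on the i-th block embeds
   the product into the unit polydisk, with an image containing the polydisk
   of radius [min r i]. *)
Require Import Defs.
From HB Require Import structures.
From mathcomp Require Import all_boot all_order all_algebra.
From mathcomp Require Import complex.
From mathcomp Require Import all_classical all_reals all_analysis.
From mathcomp Require Import zify.

Set Implicit Arguments.
Unset Strict Implicit.
Unset Printing Implicit Defensive.

Import Order.TTheory GRing.Theory Num.Theory.
Import numFieldNormedType.Exports.

Local Open Scope classical_set_scope.
Local Open Scope ring_scope.
Import tagnat.

(** * Continuity and differentiability of matrix-valued maps, entry by entry *)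

Section MatrixTopology.
Variable K : numFieldType.

Lemma mx_norm_entry_le m n (x : 'M[K]_(m, n)) i j : `|x i j| <= `|x|.
Proof.
rewrite [leRHS]/Num.norm /= mx_normE -[leLHS]nngE num_le.
exact: (le_bigmax _ (fun ij : 'I_m * 'I_n => `|x ij.1 ij.2|%:nng) (i, j)).
Qed.

Lemma mx_norm_le m n (x : 'M[K]_(m, n)) (M : K) :
  0 <= M -> (forall i j, `|x i j| <= M) -> `|x| <= M.
Proof.
move=> /nonnegP[{}M] xM; rewrite [leLHS]/Num.norm /= mx_normE num_le.
by apply/bigmax_leP; split=> [|[i j] _]; rewrite -num_le //=.
Qed.

(** A matrix has finitely many entries, so the neighbourhoods obtained for each entry intersect in
    one on which the sup norm of the difference is at most [e]. *)
Lemma continuous_mx (T : topologicalType) m n (f : T -> 'M[K]_(m, n)) (x : T) :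
  (forall i j, {for x, continuous (fun y => f y i j)}) ->
  {for x, continuous f}.
Proof.
move=> fx; apply/cvgrPdist_le => e e0.
have: \forall y \near x, forall i j, `|f x i j - f y i j| <= e.
  apply: filter_forall => i; apply: filter_forall => j.
  by have /cvgrPdist_le := fx i j; exact.
apply: filterS => y fxy; apply: mx_norm_le => [|i j]; first exact: ltW.
by rewrite !mxE.
Qed.

Lemma differentiable_rV (V : normedModType K) n (f : V -> 'rV[K]_n) (x : V) :
  (forall j, differentiable (fun y => f y ord0 j) x) -> differentiable f x.
Proof.
move=> fx.
have -> : f = \sum_(j < n) (fun y => f y ord0 j *: (delta_mx 0 j : 'rV[K]_n)).
  by apply/funext => y; rewrite fct_sumE [LHS]row_sum_delta.
by apply: differentiable_sum => j; apply: differentiableZl.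
Qed.

Lemma continuous_mxsub m n m' n' (f : 'I_m' -> 'I_m) (g : 'I_n' -> 'I_n) :
  continuous (mxsub f g : 'M[K]_(m, n) -> 'M[K]_(m', n')).
Proof.
move=> x; apply: continuous_mx => i j.
rewrite (_ : (fun y => _) = fun y : 'M[K]_(m, n) => y (f i) (g j)).
  exact: coord_continuous.
by apply/funext => y; rewrite mxE.
Qed.

End MatrixTopology.


(** * Extracting and replacing one block of a row vector *)

Section Blocks.
Variables (K : numFieldType) (k : nat) (n : 'I_k -> nat).

Lemma continuous_submxrow i :
  continuous (fun z : 'rV[K]_(\sum_i n i) => submxrow z i).
Proof. exact: continuous_mxsub. Qed.

Lemma differentiable_submxrow (z : 'rV[K]_(\sum_i n i)) i :
  differentiable (fun y : 'rV[K]_(\sum_i n i) => submxrow y i) z.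
Proof.
apply: differentiable_rV => j.
rewrite (_ : (fun y => _) = fun y : 'rV[K]_(\sum_i n i) => y ord0 (Rank i j)).
  exact: differentiable_coord.
by apply/funext => y; rewrite mxE.
Qed.

Lemma continuous_mxrow_dfwith (a : forall i, 'rV[K]_(n i)) (j : 'I_k) :
  continuous (fun u : 'rV[K]_(n j) => \mxrow_i dfwith a j u i).
Proof.
move=> u; apply: continuous_mx => r t.
rewrite (_ : (fun y => _) =
    fun y : 'rV[K]_(n j) => dfwith a j y (sig1 t) r (sig2 t)); last first.
  by apply/funext => y; rewrite mxE.
(* The position inside the block has a type depending on the block index; generalizing both allows
   [i] to be replaced by [j]. *)
move: (sig1 t) (sig2 t) => i; have [<- s|ij s] := eqVneq j i.
  rewrite (_ : (fun y => _) = fun y : 'rV[K]_(n j) => y r s).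
    exact: coord_continuous.
  by apply/funext => y; rewrite dfwithin.
rewrite (_ : (fun y => _) = fun=> a i r s); first exact: cst_continuous.
by apply/funext => y; rewrite dfwithout.
Qed.

End Blocks.

(** * The product of bounded domains is a bounded domain *)

Lemma open_product_set (R : realType) k (n : 'I_k -> nat)
    (Omega : forall i, set 'rV[cplx R]_(n i)) :
  (forall i, open (Omega i)) -> open (product_set Omega).
Proof.
move=> Oo; rewrite openE => z Oz.
suff: \forall w \near z, forall i, Omega i (submxrow w i) by [].
apply: (@filter_forall _ _ (fun i w => Omega i (submxrow w i)) _
  (nbhs_filter z)) => i.
have := @continuous_submxrow (cplx R) k n i z (Omega i); apply.
exact: open_nbhs_nbhs.
Qed.

Lemma bounded_product_set (R : realType) k (n : 'I_k -> nat)
    (Omega : forall i, set 'rV[cplx R]_(n i)) :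
  (forall i, bounded_set (Omega i)) -> bounded_set (product_set Omega).
Proof.
(* One [M] serves all blocks since they are finitely many; [0 <= M] is what bounding a norm by its
   entries requires. *)
move=> Ob; have : \forall M \near +oo,
    0 <= (M : cplx R) /\ forall i, globally (Omega i) [set x | `|x| <= M].
  apply: filterI; first exact: nbhs_pinfty_ge.
  exact: (@filter_forall _ _ (fun i M => globally (Omega i) [set x | `|x| <= M])
    (+oo_ (cplx R)) _ Ob).
apply: filterS => M [M0 OM] z Oz /=; apply: mx_norm_le => // i t.
rewrite -[z]submxrowK mxE.
exact: le_trans (mx_norm_entry_le _ _ _) (OM _ _ (Oz _)).
Qed.

(* Two points of the product are joined by changing one block at a time. *)
Lemma connected_product_set (R : realType) k (n : 'I_k -> nat)
    (Omega : forall i, set 'rV[cplx R]_(n i)) :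
  (forall i, connected (Omega i)) -> connected (product_set Omega).
Proof.
move=> Oc; have [->|/set0P[a Oa]] := eqVneq (product_set Omega) set0.
  exact: connected0.
suff -> : product_set Omega = connected_component (product_set Omega) a.
  exact: component_connected.
apply/seteqP; split; last exact: connected_component_sub.
move=> b Ob.
(* A chain from [a] to [b]: [z m] has its first [m] blocks from [b] and the others from [a]. *)
pose z m := \mxrow_i (if (i < m)%N then submxrow b i else submxrow a i).
have Oz m : product_set Omega (z m).
  by move=> i; rewrite mxrowK; case: ifP.
have aE : a = z 0%N by apply/mxrowP => i; rewrite mxrowK.
have bE : b = z k by apply/mxrowP => i; rewrite mxrowK ltn_ord.
suff conn m : (m <= k)%N ->
    connected_component (product_set Omega) (z 0%N) (z m).
  by rewrite aE bE; exact: conn.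
elim: m => [|m IH] mk; first exact: connected_component_refl.
apply: connected_component_trans (IH (ltnW mk)) _.
pose j := Ordinal mk.
pose g (u : 'rV[cplx R]_(n j)) := \mxrow_i dfwith (submxrow (z m)) j u i.
(* [z m] and [z m.+1] differ at most in block [j], of index [m], so both lie on the slice
   parametrized by [g]. *)
have gE l : (m <= l <= m.+1)%N -> z l = g (submxrow (z l) j).
  move=> /andP[ml lm]; apply/mxrowP => i.
  rewrite /g [RHS]mxrowK; have [<-|ji] := eqVneq j i; first by rewrite dfwithin.
  rewrite dfwithout// !mxrowK; suff -> : (i < l)%N = (i < m)%N by [].
  have {}ji : (i : nat) != m by rewrite eq_sym.
  by apply/idP/idP; lia.
(* This slice is a continuous image of the connected set [Omega j], stays in the product and
   contains both points. *)
apply: (@connected_component_max _ _ (g @` Omega j)).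
- by exists (submxrow (z m) j); [exact: Oz|rewrite -gE// leqnn leqnSn].
- move=> _ [u Ou <-] i; rewrite mxrowK.
  have [<-|ji] := eqVneq j i; first by rewrite dfwithin.
  by rewrite dfwithout//; exact: Oz.
- apply: connected_continuous_connected (Oc j) _.
  exact/continuous_subspaceT/continuous_mxrow_dfwith.
- by exists (submxrow (z m.+1) j); [exact: Oz|rewrite -gE// leqnn leqnSn].
Qed.

Lemma bounded_domain_product_set (R : realType) k (n : 'I_k -> nat)
    (Omega : forall i, set 'rV[cplx R]_(n i)) :
  (forall i, bounded_domain (Omega i)) -> bounded_domain (product_set Omega).
Proof.
move=> OD; split.
- by apply: open_product_set => i; case: (OD i).
- by apply: connected_product_set => i; case: (OD i).
- by apply: bounded_product_set => i; case: (OD i).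
Qed.

(** * Polydisks, product embeddings and the squeezing function *)

Lemma polydisk_submxrow (R : realType) k (n : 'I_k -> nat) (r : R)
    (w : 'rV[cplx R]_(\sum_i n i)) :
  polydisk r w <-> forall i, polydisk r (submxrow w i).
Proof.
split=> [wr i j|wr t]; first by rewrite mxE.
by rewrite -[w]submxrowK mxE; exact: wr.
Qed.

Lemma polydiskS (R : realType) n (r s : R) :
  r <= s -> @polydisk R n r `<=` polydisk s.
Proof.
by move=> rs w wr i; apply: lt_le_trans (wr i) _; rewrite lecR.
Qed.

Definition product_map (R : realType) k (n : 'I_k -> nat)
    (f : forall i, 'rV[cplx R]_(n i) -> 'rV[cplx R]_(n i))
    (z : 'rV[cplx R]_(\sum_i n i)) : 'rV[cplx R]_(\sum_i n i) :=
  \mxrow_i f i (submxrow z i).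

Lemma holomorphic_embedding_product_map (R : realType) k (n : 'I_k -> nat)
    (Omega : forall i, set 'rV[cplx R]_(n i))
    (f : forall i, 'rV[cplx R]_(n i) -> 'rV[cplx R]_(n i)) (r : R) :
  (forall i, holomorphic_embedding (Omega i) (polydisk r) (f i)) ->
  holomorphic_embedding (product_set Omega) (polydisk r) (product_map f).
Proof.
move=> fe; split.
- move=> z Oz; apply: differentiable_rV => t.
  (* Coordinate [t] of the product map is a block projection, followed by one [f i], followed by a
     coordinate. *)
  rewrite (_ : (fun y => _) = (fun v : 'rV_(n (sig1 t)) => v ord0 (sig2 t)) \o
      (f (sig1 t) \o fun y => submxrow y (sig1 t))); last first.
    by apply/funext => y; rewrite mxE.
  apply: differentiable_comp; last exact: differentiable_coord.
  apply: differentiable_comp; first exact: differentiable_submxrow.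
  by have [+ _ _] := fe (sig1 t); apply.
- move=> z w Oz Ow /mxrowP fzw; apply/mxrowP => i.
  have [_ + _] := fe i; apply => //.
  by have := fzw i; rewrite !mxrowK.
- move=> _ [z Oz <-]; apply/polydisk_submxrow => i; rewrite mxrowK.
  by have [_ _] := fe i; apply; exists (submxrow z i).
Qed.

(** Strict lower bounds unfold both suprema into one embedding and one radius, whether or not the
    suprema are attained. *)
Lemma lt_squeezingP (R : realType) n (Omega : set 'rV[cplx R]_n) z
    (x : \bar R) :
  (x < squeezing Omega z)%E <->
  exists (f : 'rV[cplx R]_n -> 'rV[cplx R]_n) (r : R),
    [/\ holomorphic_embedding Omega (polydisk 1) f /\ f z = 0,
    0 < r, polydisk r `<=` f @` Omega & (x < r%:E)%E].
Proof.
split.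
  move=> /ereal_sup_gt[_ [f fe <-]] /ereal_sup_gt[_ [r [r0 rf] <-] xr].
  by exists f, r.
move=> [f [r [fe r0 rf xr]]].
apply/ereal_sup_gtP; exists (ereal_sup [set s%:E | s in
    [set s : R | 0 < s /\ polydisk s `<=` f @` Omega]]); first by exists f.
by apply/ereal_sup_gtP; exists r%:E => //; exists r.
Qed.

(** By contradiction: were the value at [a] below the minimum, every factor would have an embedding
    with a radius exceeding that value, and the product map would make the value strictly smaller
    than itself. *)
Lemma squeezing_product_set (R : realType) k (n : 'I_k -> nat)
    (Omega : forall i, set 'rV[cplx R]_(n i)) (a : 'rV[cplx R]_(\sum_i n i)) :
  (0 < k)%N ->
  (\big[Order.min/+oo]_(i < k) squeezing (Omega i) (submxrow a i)
     <= squeezing (product_set Omega) a)%E.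
Proof.
move=> k0; rewrite leNgt; apply/negP => /bigmin_gtP[_ ltS].
have F i := cid ((lt_squeezingP _ _ _).1 (ltS i isT)).
pose f i := projT1 (F i).
have /choice[r fr] := fun i => projT2 (F i).
(* As [0 < k], the default can be one of the radii, so [s] is exactly their minimum. *)
pose i0 := Ordinal k0; pose s := \big[Order.min/r i0]_i r i.
have r0 i : 0 < r i by case: (fr i).
have xr i : (squeezing (product_set Omega) a < (r i)%:E)%E by case: (fr i).
suff : (squeezing (product_set Omega) a < squeezing (product_set Omega) a)%E.
  by rewrite ltxx.
apply/lt_squeezingP; exists (product_map f), s; split.
- split.
    by apply: holomorphic_embedding_product_map => i; case: (fr i) => -[].
  apply/mxrowP => i; rewrite mxrowK submxrow0.
  by case: (fr i) => -[].
- exact: lt_bigmin.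
- move=> w /polydisk_submxrow ws.
  (* Since [s <= r i], each block of [w] has a preimage under [f i]; these are assembled into a
     preimage of [w]. *)
  have Z i : {z | Omega i z & f i z = submxrow w i}.
    apply: cid2; have [_ _ rf _] := fr i; apply: rf.
    by apply: polydiskS (ws i); exact: bigmin_le.
  exists (\mxrow_i s2val (Z i)) => [i|].
    by rewrite mxrowK; case: (Z i).
  by apply/mxrowP => i; rewrite !mxrowK; case: (Z i).
(* The strict bound holds for the default and every [r i], and passes to the minimum of two
   reals. *)
- apply: (big_ind (fun u => (squeezing (product_set Omega) a < u%:E)%E)) => //.
  by move=> x y ? ?; rewrite /Order.min; case: ifP.
Qed.

Theorem proposition4p6 (R : realType) (k : nat) (hk : (0 < k)%N)
    (n : 'I_k -> nat) (hn : forall i, (0 < n i)%N)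
    (Omega : forall i, set 'rV[cplx R]_(n i))
    (hOmega : forall i, bounded_domain (Omega i)) :
  (forall a : 'rV[cplx R]_(\sum_i n i), product_set Omega a ->
     (\big[Order.min/+oo]_(i < k) squeezing (Omega i) (submxrow a i)
        <= squeezing (product_set Omega) a)%E) /\
  ((forall i, holomorphic_homogeneous_regular (Omega i)) ->
   holomorphic_homogeneous_regular (product_set Omega)).
Proof.
split=> [a _|hhr]; first exact: squeezing_product_set.
split; first exact: bounded_domain_product_set.
have /choice[c hc] := fun i => (hhr i).2.
(* The default 1 only caps the constant, which stays positive and below every [c i]. *)
exists (\big[Order.min/1]_i c i); split.
  by apply: lt_bigmin => // i _; case: (hc i).
move=> z Oz; apply: le_trans (squeezing_product_set _ _ hk).
apply: le_bigmin => [|i _]; first exact: leey.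
have [_ /(_ _ (Oz i))] := hc i; apply: le_trans.
by rewrite lee_fin; exact: bigmin_le.
Qed.
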